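(* Let $0<\alpha<2$ and let $n\ge 0$ be an integer. Then for all $x\in\mathbb{R}$, $$(-\Delta)^{\alpha/2}\widetilde{H}_{2n+1}(x)=2^{\alpha+1}\,\frac{(-1)^{n}\sqrt{(2n+1)!}}{2^{n+\frac12}\,n!}\,\frac{\Gamma\left(n+\frac{\alpha}{2}+\frac32\right)}{\Gamma\left(n+\frac32\right)}\;x\;{}_1F_1\left(n+\frac{\alpha}{2}+\frac32,\ \frac32;\ -x^2\right).$$
   Context: The Hermite polynomials are defined by $H_0(x)=1$, $H_1(x)=2x$, $H_{n+1}(x)=2xH_n(x)-2nH_{n-1}(x)$ for $n\ge1$. The over-scaled Hermite functions are $$\widetilde{H}_n(x)=\frac{1}{\sqrt{2^n n!}}\,e^{-x^2}H_n(x),\qquad x\in\mathbb{R}.$$ The confluent hypergeometric function is ${}_1F_1(a,b;x)=\sum_{k=0}^\infty \frac{(a)_k}{(b)_k}\frac{x^k}{k!}$, where $(a)_0=1$ and $(a)_k=a(a+1)\cdots(a+k-1)$. The fractional Laplacian on $\mathbb{R}$ is defined via the Fourier transform by $\mathcal{F}[(-\Delta)^{\alpha/2}u](\xi)=|\xi|^\alpha\,\mathcal{F}[u](\xi)$, where $\mathcal{F}[u](\xi)=\frac{1}{\sqrt{2\pi}}\int_{\mathbb{R}}u(x)e^{-\mathrm{i}x\xi}\,dx$; that is, $(-\Delta)^{\alpha/2}u(x)=\frac{1}{\sqrt{2\pi}}\int_{\mathbb{R}}|\xi|^\alpha\mathcal{F}[u](\xi)e^{\mathrm{i}x\xi}\,d\xi$.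 *)

(* Defs.v *)
From mathcomp Require Import all_boot all_order all_algebra.
From mathcomp Require Import all_classical all_reals all_analysis.
From mathcomp Require Export complex.

Set Implicit Arguments.
Unset Strict Implicit.
Unset Printing Implicit Defensive.

Import Order.TTheory GRing.Theory Num.Theory.
Import numFieldNormedType.Exports.

Local Open Scope classical_set_scope.
Local Open Scope ring_scope.
Local Open Scope complex_scope.

Section special_functions.
Variable R : realType.

Fixpoint hermite (n : nat) : {poly R} :=
  match n with
  | 0 => 1
  | m.+1 => match m with
            | 0 => 2 *: 'X
            | k.+1 => 2 *: 'X * hermite m - (2 * m)%:R *: hermite k
            end
  end.

Definition over_scaled_hermite (n : nat) (x : R) : R :=
  (Num.sqrt (2 ^+ n * n`!%:R))^-1 * expR (- x ^+ 2) * (hermite n).[x].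

Definition pochhammer (a : R) (k : nat) : R := \prod_(i < k) (a + i%:R).

Definition hyp1F1 (a b x : R) : R :=
  limn (series (fun k : nat =>
    pochhammer a k / pochhammer b k * (x ^+ k / k`!%:R))).

(* Euler's integral: this is Gamma only for [0 < z]; for other [z] the integral
   diverges and the value is meaningless. *)
Definition Gamma (z : R) : R :=
  \int[@lebesgue_measure R]_(t in `]0, +oo[) (t `^ (z - 1) * expR (- t)).

End special_functions.

Section fractional_laplacian.
Variable R : realType.
Implicit Types (f u : R -> R[i]) (alpha x xi : R).

Definition cintegrable f : Prop :=
  (@lebesgue_measure R).-integrable setT (fun t => (complex.Re (f t))%:E) /\
  (@lebesgue_measure R).-integrable setT (fun t => (complex.Im (f t))%:E).

Definition cintegral f : R[i] :=
  (\int[@lebesgue_measure R]_t complex.Re (f t)) +i*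
  (\int[@lebesgue_measure R]_t complex.Im (f t)).

Definition expi (theta : R) : R[i] := cos theta +i* sin theta.

Definition fourier_integrand u xi : R -> R[i] :=
  fun x => u x * expi (- (x * xi)).

Definition fourier u xi : R[i] :=
  ((Num.sqrt (2 * pi))^-1)%:C * cintegral (fourier_integrand u xi).

Definition frac_laplacian_integrand alpha u x : R -> R[i] :=
  fun xi => (`|xi| `^ alpha)%:C * fourier u xi * expi (x * xi).

Definition frac_laplacian alpha u x : R[i] :=
  ((Num.sqrt (2 * pi))^-1)%:C * cintegral (frac_laplacian_integrand alpha u x).

(* The integral is total (it is 0, say, on non-integrable integrands), so that
   the absolute convergence of the integrals defining [frac_laplacian alpha u x]
   has to be asserted separately. *)
Definition frac_laplacian_defined alpha u x : Prop :=
  (forall xi, cintegrable (fourier_integrand u xi)) /\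
  cintegrable (frac_laplacian_integrand alpha u x).

End fractional_laplacian.

(* Main.v *)
(** The function [exp(-t^2) H_n(t)] is [(-1)^n] times the [n]-th derivative of
[exp(-t^2)], so integrating by parts [2n+1] times turns its Fourier transform
into [(-i xi)^(2n+1)] times that of the Gaussian. Applying [|xi|^alpha] and the
inverse transform leaves, by parity, only the sine transform of
[|xi|^alpha xi^(2n+1) exp(-xi^2/4)]. Expanding the sine and integrating term by
term (the partial sums are dominated because [exp(|x| |t| - c t^2)] decays),
one is left with the absolute moments of a Gaussian. These satisfy
[m(q+2) = (q+1)/(2c) m(q)], which produces the Pochhammer symbols of the series
[1F1], and the substitution [s = c t^2] relates [m] to [Gamma]. *)

Require Import Defs.
From mathcomp Require Import all_boot all_order all_algebra.
From mathcomp Require Import all_classical all_reals all_analysis.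
From mathcomp Require Import measurable_realfun ring lra.

Set Implicit Arguments.
Unset Strict Implicit.
Unset Printing Implicit Defensive.

Import Order.TTheory GRing.Theory Num.Theory.
Import numFieldNormedType.Exports.

Local Open Scope ring_scope.
Local Open Scope complex_scope.

(** * Improper integrals as limits over exhausting sequences *)

Section improper_integrals.
Local Open Scope classical_set_scope.
Local Open Scope ring_scope.
Variable R : realType.
Local Notation mu := (@lebesgue_measure R).

Lemma integrable_oneDsqrV (D : set R) : measurable D ->
  mu.-integrable D (fun t => ((oneDsqr t)^-1)%:E).
Proof.
move=> mD; apply: (integrableS measurableT) => //.
have mV : measurable_fun setT (fun t : R => (oneDsqr t)^-1).
  by apply: continuous_measurable_fun; exact: continuous_oneDsqrV.
apply/integrableP; split; first exact/measurable_EFinP.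
under eq_integral do rewrite gee0_abs ?lee_fin ?invr_ge0 ?addr_ge0 ?sqr_ge0//.
rewrite (ge0_symfun_integralT (f := fun t : R => (oneDsqr t)^-1)).
- rewrite (_ : [set x | _] = `[0, +oo[%classic); last first.
    by apply/seteqP; split => x/=; rewrite in_itv/= andbT.
  by rewrite integral0y_oneDsqr -EFinM ltry.
- by move=> t; rewrite invr_ge0 addr_ge0 ?sqr_ge0.
- exact: continuous_oneDsqrV.
- by move=> t /=; rewrite /oneDsqr sqrrN.
Qed.

(** Decay like [C / (1 + t^2)] is the integrability criterion for the Gaussian weights, the Gamma
    integrand and the Hermite functions below. *)
Lemma integrable_oneDsqr_bound (D : set R) (f : R -> R) (C : R) :
  measurable D -> measurable_fun D f ->
  (forall t, D t -> `|f t| * oneDsqr t <= C) ->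
  mu.-integrable D (EFin \o f).
Proof.
move=> mD mf fC.
have := @integrableZl _ _ R mu D mD C _ (integrable_oneDsqrV mD).
apply: le_integrable => //; first exact/measurable_EFinP.
move=> t Dt /=; rewrite lee_fin (le_trans _ (ler_norm _))//.
by rewrite ler_pdivlMr ?fC.
Qed.

(** Dominated convergence for [f] restricted to [E n], with bound [|f|]: at each point of [D] the
    restrictions are eventually equal to [f]. *)
Lemma cvg_Rintegral_exhaust (D : set R) (E : (set R)^nat) (f : R -> R) :
  measurable D -> (forall n, measurable (E n)) -> (forall n, E n `<=` D) ->
  (forall t, D t -> \forall n \near \oo, E n t) ->
  mu.-integrable D (EFin \o f) ->
  \int[mu]_(t in E n) f t @[n --> \oo] --> \int[mu]_(t in D) f t.
Proof.
move=> mD mE ED DE fi.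
have mf : measurable_fun D (EFin \o f) by case/integrableP: fi.
have [||||_ _] := @dominated_convergence _ _ _ mu D mD
  (fun n => (EFin \o f) \_ (E n)) (EFin \o f) (abse \o (EFin \o f)) _ mf.
- move=> n; apply/(measurable_restrict _ (mE n) mD).
  by apply: measurable_funS mf => //; exact: subIsetr.
- apply/aeW => t Dt; apply: cvg_near_cst.
  by apply: filterS (DE t Dt) => n Ent; rewrite patchE mem_set.
- exact: integrable_abse.
- apply/aeW => t n _ /=; rewrite patchE.
  by case: ifPn => //= _; rewrite normr0 lee_fin.
move=> H; apply: fine_cvg; rewrite fineK; last exact: integrable_fin_num.
apply: cvg_trans H; apply: near_eq_cvg; apply: nearW => n /=.
rewrite -integral_mkcondr; congr integral.
by apply/setIidPr.
Qed.

Lemma integrable_mulrl (D : set R) (f : R -> R) (k : R) : measurable D ->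
  mu.-integrable D (EFin \o f) -> mu.-integrable D (EFin \o (fun t => k * f t)).
Proof. by move=> mD fi; exact: (@integrableZl _ _ R mu D mD k _ fi). Qed.

Lemma integrable_sub (D : set R) (f g : R -> R) : measurable D ->
  mu.-integrable D (EFin \o f) -> mu.-integrable D (EFin \o g) ->
  mu.-integrable D (EFin \o (fun t => f t - g t)).
Proof. by move=> mD fi gi; exact: (@integrableB _ _ R mu D mD _ _ fi gi). Qed.

End improper_integrals.

(** * The fundamental theorem of calculus on the line and the half-line *)

Section improper_ftc.
Local Open Scope classical_set_scope.
Local Open Scope ring_scope.
Variable R : realType.
Local Notation mu := (@lebesgue_measure R).

Definition exhausts (D : set R) (a b : R^nat) :=
  [/\ forall n, a n < b n, forall n, `[a n, b n] `<=` D &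
      forall t, D t -> \forall n \near \oo, t \in `[a n, b n]].

Lemma cvg_Rintegral_itv (D : set R) (a b : R^nat) (f : R -> R) :
  measurable D -> exhausts D a b -> mu.-integrable D (EFin \o f) ->
  \int[mu]_(t in `[a n, b n]) f t @[n --> \oo] --> \int[mu]_(t in D) f t.
Proof.
move=> mD [ab abD Dab] fi.
by apply: cvg_Rintegral_exhaust => // t /Dab.
Qed.

Lemma is_derive_continuous (F : R -> R) (t d : R) :
  is_derive t 1 F d -> {for t, continuous F}.
Proof. by case=> dF _; exact/differentiable_continuous/derivable1_diffP. Qed.

Lemma exhaust_FTC2 (D : set R) (a b : R^nat) (f F : R -> R) (l : R) :
  measurable D -> exhausts D a b -> mu.-integrable D (EFin \o f) ->
  (forall t, D t -> {for t, continuous f}) ->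
  (forall t, D t -> is_derive t 1 F (f t)) ->
  F (b n) - F (a n) @[n --> \oo] --> l ->
  \int[mu]_(t in D) f t = l.
Proof.
move=> mD abD fi cf dF Fl.
apply: (cvg_unique _ (cvg_Rintegral_itv mD abD fi)) => //.
case: abD => ab abD _.
apply: cvg_trans Fl; apply: near_eq_cvg; apply: nearW => n /=.
rewrite /Rintegral (@continuous_FTC2 _ f F)//.
- apply: continuous_in_subspaceT => t /set_mem tab.
  by apply: cf; exact: (abD n).
- split.
  + move=> t /subset_itv_oo_cc tab; have /dF[] // : D t by exact: (abD n).
  + apply: cvg_at_right_filter; apply: is_derive_continuous; apply: dF.
    by apply: (abD n); rewrite /= bound_itvE ltW.
  + apply: cvg_at_left_filter; apply: is_derive_continuous; apply: dF.
    by apply: (abD n); rewrite /= bound_itvE ltW.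
- move=> t /subset_itv_oo_cc tab; rewrite derive1E.
  by have /dF[] : D t by exact: (abD n).
Qed.

Lemma exhausts_setT : exhausts setT (fun n => - n.+1%:R) (fun n => n.+1%:R).
Proof.
split => // [n|t _]; first by rewrite gtrN.
exists (Num.trunc `|t|) => // n /= tn.
rewrite in_itv/= -ler_norml ltW// (lt_le_trans (truncnS_gt _))//.
by rewrite ler_nat.
Qed.

(** The shift by 2 keeps the interval from [1/(n+2)] to [n+2] non-degenerate already at [n = 0]. *)
Lemma exhausts_gt0 :
  exhausts `]0, +oo[ (fun n => n.+2%:R^-1) (fun n => n.+2%:R).
Proof.
split=> [n|n t|t].
- by rewrite (@lt_trans _ _ 1)// ?invf_lt1// ltr1n.
- by rewrite /= !in_itv/= andbT => /andP[+ _]; apply: lt_le_trans; rewrite invr_gt0.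
- rewrite /= in_itv/= => /andP[t0 _].
  (* An index beyond [t + 1/t] serves both ends, since then [n+2] exceeds both [t] and [1/t]. *)
  exists (Num.trunc (t + t^-1)) => // n /= tn.
  have ttn : t + t^-1 <= n.+2%:R.
    rewrite ltW// (lt_le_trans (truncnS_gt _))// ler_nat.
    by rewrite ltnW// !ltnS.
  have ti : 0 < t^-1 by rewrite invr_gt0.
  rewrite in_itv/=; apply/andP; split; last by apply: le_trans ttn; rewrite lerDl ltW.
  rewrite -[leRHS]invrK lef_pV2 ?posrE//.
  by apply: le_trans ttn; rewrite lerDr ltW.
Qed.

Lemma cvgr_idnD (k : nat) : ((n + k)%:R : R) @[n --> \oo] --> +oo.
Proof. by rewrite (cvg_shiftn k (fun n => n%:R : R)); exact: cvgr_idn. Qed.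

Lemma Rintegral_FTC2T (f F : R -> R) (l m : R) :
  mu.-integrable setT (EFin \o f) -> continuous f ->
  (forall t : R, is_derive t 1 F (f t)) ->
  F t @[t --> +oo] --> l -> F t @[t --> -oo] --> m ->
  \int[mu]_t f t = l - m.
Proof.
move=> fi cf dF Fl Fm.
apply: (exhaust_FTC2 _ exhausts_setT fi) => //.
  by move=> t _; exact: cf.
apply: cvgB.
  by move/cvg_pinftyP: Fl; apply; under eq_fun do rewrite -addn1; exact: cvgr_idnD.
move/cvgNy_compNP/cvg_pinftyP : Fm; apply.
by under eq_fun do rewrite -addn1; exact: cvgr_idnD.
Qed.

Lemma Rintegral_FTC2_gt0 (f F : R -> R) (l m : R) :
  mu.-integrable `]0, +oo[ (EFin \o f) ->
  (forall t, 0 < t -> {for t, continuous f}) ->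
  (forall t : R, 0 < t -> is_derive t 1 F (f t)) ->
  F t @[t --> +oo] --> l -> F t @[t --> 0^'+] --> m ->
  \int[mu]_(t in `]0, +oo[) f t = l - m.
Proof.
move=> fi cf dF Fl Fm.
have gt0 (t : R) : [set` `]0, +oo[] t -> 0 < t by rewrite /= in_itv/= andbT.
apply: (exhaust_FTC2 _ exhausts_gt0 fi) => //.
- by move=> t /gt0; exact: cf.
- by move=> t /gt0; exact: dF.
apply: cvgB.
  move/cvg_pinftyP: Fl; apply; under eq_fun do rewrite -addn2.
  exact: cvgr_idnD.
move/cvg_at_rightP: Fm; apply; split => [n|]; first by rewrite invr_gt0.
by rewrite (cvg_shiftS (fun n => n.+1%:R^-1 : R)); exact: cvg_harmonic.
Qed.

(** On each symmetric interval the substitution of [-t] for [t] shows the integral to be its own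
    opposite, hence 0. *)
Lemma Rintegral_odd (f : R -> R) :
  mu.-integrable setT (EFin \o f) -> continuous f -> (forall t, f (- t) = - f t) ->
  \int[mu]_t f t = 0.
Proof.
move=> fi cf fN.
apply: (cvg_unique _ (cvg_Rintegral_itv measurableT exhausts_setT fi)) => //.
apply: cvg_near_cst; apply: nearW => n; apply/eqP; rewrite -eqNr; apply/eqP.
have ci : {within `[(- n.+1%:R), (n.+1%:R : R)], continuous f}.
  exact: continuous_subspaceT.
have le_N : - n.+1%:R <= n.+1%:R :> R by rewrite (@le_trans _ _ 0)// lerNl oppr0.
have := integration_by_substitution_oppr (G := f) le_N; rewrite opprK => /(_ ci) fE.
rewrite {2}/Rintegral fE; under eq_integral do rewrite /= fN.
have fin : mu.-integrable `[(- n.+1%:R), (n.+1%:R : R)] (EFin \o f).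
  by apply: (integrableS measurableT) fi.
rewrite -[RHS]/(\int[mu]_(t in `[(- n.+1%:R), n.+1%:R]) (- f t)).
under [RHS]eq_Rintegral do rewrite -mulN1r.
by rewrite RintegralZl// mulN1r.
Qed.

End improper_ftc.

(** * Absolute moments of Gaussians and the Gamma function *)

Section gaussian_weights.
Local Open Scope classical_set_scope.
Local Open Scope ring_scope.
Variable R : realType.
Local Notation mu := (@lebesgue_measure R).

Lemma continuous_norm_powR (q : R) : 0 <= q -> continuous (fun t : R => `|t| `^ q).
Proof.
rewrite le_eqVlt => /predU1P[<-|q0] t.
  (* Exponent 0 gives the constant 1, also at base 0. *)
  by under eq_fun do rewrite powRr0; exact: cst_continuous.
have [->|t0] := eqVneq t 0; last first.
  apply: (@continuous_comp _ _ _ (fun t : R => `|t|) (fun t => t `^ q)).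
    exact: norm_continuous.
  apply/differentiable_continuous/derivable1_diffP.
  by apply: derivable_powR; rewrite in_itv/= andbT normr_gt0.
have q1 : 0 < q^-1 by rewrite invr_gt0.
apply/cvgrPdist_lt => e e0; rewrite normr0 powR0 ?gt_eqF//.
near=> x; rewrite sub0r normrN ger0_norm ?powR_ge0//.
(* At 0 the claim reduces to [|x| < e^(1/q)], by monotonicity of the power. *)
have -> : e = (e `^ q^-1) `^ q by rewrite -powRrM mulVf ?gt_eqF// powRr1// ltW.
rewrite gt0_ltr_powR// ?nnegrE ?powR_ge0//.
near: x; apply: (@nbhs0_lt _ R^o); exact: powR_gt0.
Unshelve. all: by end_near. Qed.

Lemma powR_le_expR (q : R) : 0 <= q ->
  exists2 K : R, 0 <= K & forall t : R, 0 <= t -> t `^ q <= K * expR t.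
Proof.
move=> q0; pose m := Num.trunc q.
(* For [t >= 1], [t^q <= t^(m+1)], and the term [t^(m+1)/(m+1)!] of the exponential series is at
   most [expR t]; for [t <= 1] the power is at most 1. *)
exists (m.+1`!%:R) => [|t t0]; first exact: ler0n.
have [t1|/ltW t1] := leP t 1.
  rewrite (@le_trans _ _ 1)//.
    by have := @ge0_ler_powR _ q q0 t 1; rewrite powR1 !nnegrE; apply.
  by rewrite -[leLHS]mulr1 ler_pM// ?ler1n ?fact_gt0// -expR0 ler_expR.
have qm : q <= m.+1%:R by rewrite ltW// truncnS_gt.
rewrite (le_trans (ler_powR t1 qm))// powR_mulrn//.
rewrite mulrC -ler_pdivrMr ?ltr0n ?fact_gt0//.
by apply: le_trans (expR_ge1Dxn m t0); rewrite lerDr.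
Qed.

Lemma powR_oneDsqr_le_expR (q : R) : 0 <= q ->
  exists2 K : R, 0 <= K & forall t : R, 0 <= t -> t `^ q * oneDsqr t <= K * expR t.
Proof.
move=> q0; have [K K0 HK] := powR_le_expR q0.
have q2 : 0 <= q + 2 by rewrite addr_ge0.
have [L L0 HL] := powR_le_expR q2.
exists (K + L) => [|t t0]; first exact: addr_ge0.
rewrite /oneDsqr mulrDr mulr1 mulrDl lerD ?HK//.
rewrite -powR_mulrn// -powRD ?HL//.
by apply/implyP => /eqP E; exfalso; lra.
Qed.

(** The absolute value allows real exponents and makes the weight even. The case needed in the end
    is [c = 1/4], [q = alpha + 2n]. *)
Definition gauss_weight (c q t : R) := `|t| `^ q * expR (- (c * t ^+ 2)).

Lemma gauss_weight_ge0 c q t : 0 <= gauss_weight c q t.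
Proof. by rewrite mulr_ge0 ?powR_ge0 ?expR_ge0. Qed.

Lemma gauss_weightN c q t : gauss_weight c q (- t) = gauss_weight c q t.
Proof. by rewrite /gauss_weight normrN sqrrN. Qed.

(** One factor [exp |t|] absorbs [|t|^q (1 + t^2)]. The remaining exponent [(b+1)|t| - c t^2] has
    maximum [(b+1)^2/(4c)], by completing the square. The factor [exp (b |t|)] is there to dominate
    partial sums of the sine and cosine series. *)
Lemma gauss_weight_bound (c q b : R) : 0 < c -> 0 <= q ->
  exists K, forall t, gauss_weight c q t * expR (b * `|t|) * oneDsqr t <= K.
Proof.
move=> c0 q0; have [K K0 HK] := powR_oneDsqr_le_expR q0.
exists (K * expR ((b + 1) ^+ 2 / (4 * c))) => t.
have -> : oneDsqr t = oneDsqr `|t| by rewrite /oneDsqr real_normK// num_real.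
rewrite /gauss_weight mulrAC -mulrA mulrACA.
rewrite (@le_trans _ _ (K * expR `|t| * (expR (b * `|t|) * expR (- (c * t ^+ 2)))))//.
  by rewrite [X in _ <= _ * X]mulrC ler_wpM2r ?HK// mulr_ge0// expR_ge0.
rewrite -mulrA ler_wpM2l// -!expRD ler_expR.
rewrite -(@real_normK _ t) ?num_real//.
rewrite ler_pdivlMr ?mulr_gt0//.
rewrite -subr_ge0.
have -> : (b + 1) ^+ 2 - (`|t| + (b * `|t| - c * `|t| ^+ 2)) * (4 * c) =
  (b + 1 - 2 * c * `|t|) ^+ 2 by ring.
exact: sqr_ge0.
Qed.

Lemma continuous_gauss_weight (c q : R) : 0 <= q -> continuous (gauss_weight c q).
Proof.
move=> q0 t; apply: cvgM; first exact: continuous_norm_powR.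
apply: (@continuous_comp _ _ _ (fun t : R => - (c * t ^+ 2)) expR).
  by apply: cvgN; apply: cvgM; [exact: cvg_cst|exact: exprn_continuous].
exact: continuous_expR.
Qed.

Lemma measurable_gauss_weight (c q : R) : 0 <= q -> measurable_fun setT (gauss_weight c q).
Proof. by move=> q0; apply: continuous_measurable_fun; exact: continuous_gauss_weight. Qed.

Lemma integrable_gauss_weight_expR (c q b : R) (f : R -> R) (D : set R) :
  0 < c -> 0 <= q -> measurable D -> measurable_fun D f ->
  (forall t, D t -> `|f t| <= gauss_weight c q t * expR (b * `|t|)) ->
  mu.-integrable D (EFin \o f).
Proof.
move=> c0 q0 mD mf fb; have [K HK] := gauss_weight_bound b c0 q0.
apply: (integrable_oneDsqr_bound (C := K)) => // t Dt.
by apply: le_trans (HK t); rewrite ler_wpM2r ?fb// addr_ge0// sqr_ge0.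
Qed.

Lemma integrable_gauss_weight (c q : R) (D : set R) : 0 < c -> 0 <= q -> measurable D ->
  mu.-integrable D (EFin \o gauss_weight c q).
Proof.
move=> c0 q0 mD; apply: (@integrable_gauss_weight_expR c q 0) => //.
  by apply: measurable_funTS; exact: measurable_gauss_weight.
by move=> t _; rewrite mul0r expR0 mulr1 ger0_norm// gauss_weight_ge0.
Qed.

Definition half_moment (c q : R) := \int[mu]_(t in `]0, +oo[) gauss_weight c q t.

Definition moment (c q : R) := \int[mu]_t gauss_weight c q t.

Lemma momentE (c q : R) : 0 < c -> 0 <= q -> moment c q = 2 * half_moment c q.
Proof.
move=> c0 q0.
rewrite /moment /Rintegral ge0_symfun_integralT.
- rewrite (_ : [set x | _] = `[0, +oo[%classic); last first.
    by apply/seteqP; split => x/=; rewrite in_itv/= andbT.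
  rewrite -integral_itv_obnd_cbnd; last first.
    apply/measurable_EFinP; apply: measurable_funTS; exact: measurable_gauss_weight.
  rewrite fineM//; apply: integrable_fin_num => //; exact: integrable_gauss_weight.
- exact: gauss_weight_ge0.
- exact: continuous_gauss_weight.
- by move=> t; rewrite /= gauss_weightN.
Qed.

End gaussian_weights.

(** * Recurrence for the moments and their expression through Gamma *)

Section gaussian_moments.
Local Open Scope classical_set_scope.
Local Open Scope ring_scope.
Variable R : realType.
Local Notation mu := (@lebesgue_measure R).

Lemma oneDsqr_bound_cvgy (f : R -> R) (C : R) :
  (forall t, `|f t| * oneDsqr t <= C) -> f t @[t --> +oo] --> 0.
Proof.
move=> fC; apply/cvgr0Pnorm_lt => e e0; near=> t.
have t0 : 0 < oneDsqr t by rewrite /oneDsqr ltr_pwDl ?sqr_ge0.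
rewrite -(ltr_pM2r t0) (le_lt_trans (fC t))// -ltr_pdivrMl// mulrC.
apply: (@lt_le_trans _ _ t).
  by near: t; apply: nbhs_pinfty_gt; exact: num_real.
(* From [(t-1)^2 >= 0] and [t >= 0] follows [t <= 1 + t^2]. *)
have := sqr_ge0 (t - 1); rewrite /oneDsqr => H.
have t1 : 0 <= t by near: t; apply: nbhs_pinfty_ge; exact: num_real.
nra.
Unshelve. all: by end_near. Qed.

Lemma oneDsqr_bound_cvgNy (f : R -> R) (C : R) :
  (forall t, `|f t| * oneDsqr t <= C) -> f t @[t --> -oo] --> 0.
Proof.
move=> fC; apply/cvgNy_compNP; apply: (@oneDsqr_bound_cvgy _ C) => t /=.
by have := fC (- t); rewrite /oneDsqr sqrrN.
Qed.

(** Integration by parts: [F t = t^(q+1) exp(-c t^2)] tends to 0 at both ends of the half-line, so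
    its derivative [f], a combination of the weights of exponents [q] and [q+2], has integral 0. *)
Lemma half_momentS (c q : R) : 0 < c -> 0 <= q ->
  half_moment c (q + 2) = (q + 1) / (2 * c) * half_moment c q.
Proof.
move=> c0 q0.
have q1 : 0 <= q + 1 by rewrite addr_ge0.
have q2 : 0 <= q + 2 by rewrite addr_ge0.
have mD : measurable (`]0, +oo[%classic : set R) by exact: measurable_itv.
pose F (t : R) := t `^ (q + 1) * expR (- (c * t ^+ 2)).
pose f t := (q + 1) * gauss_weight c q t - (2 * c) * gauss_weight c (q + 2) t.
have i1 : mu.-integrable `]0, +oo[ (EFin \o (fun t => (q + 1) * gauss_weight c q t)).
  by apply: integrable_mulrl => //; exact: integrable_gauss_weight.
have i2 : mu.-integrable `]0, +oo[ (EFin \o (fun t => (2 * c) * gauss_weight c (q + 2) t)).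
  by apply: integrable_mulrl => //; exact: integrable_gauss_weight.
have FE (t : R) : 0 < t -> gauss_weight c (q + 1) t = F t.
  by move=> t0; rewrite /gauss_weight gtr0_norm.
have : \int[mu]_(t in `]0, +oo[) f t = 0 - 0.
  apply: (@Rintegral_FTC2_gt0 _ f F).
  - exact: integrable_sub.
  - move=> t t0; apply: cvgB; apply: cvgM; try exact: cvg_cst.
      exact: continuous_gauss_weight.
    exact: continuous_gauss_weight.
  - move=> t t0.
    have dp := is_derive1_powR (q + 1) t0.
    apply: is_derive_eq.
    rewrite /f /gauss_weight gtr0_norm//.
    rewrite addrK !powRD; try by rewrite (gt_eqF t0) implybT.
    rewrite powRr1 ?powR_mulrn ?(ltW t0)// /GRing.scale /=; ring.
  - have [K HK] := gauss_weight_bound 0 c0 q1.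
    have : gauss_weight c (q + 1) t @[t --> +oo] --> 0.
      apply: (@oneDsqr_bound_cvgy _ K) => t.
      apply: le_trans (HK t).
      by rewrite mul0r expR0 mulr1 ger0_norm// gauss_weight_ge0.
    apply: cvg_trans; apply: near_eq_cvg; near=> t.
    by rewrite FE//; near: t; exact: nbhs_pinfty_gt.
  - have : gauss_weight c (q + 1) t @[t --> 0^'+] --> 0.
      apply: cvg_at_right_filter.
      have := @continuous_gauss_weight R c _ q1 0.
      by rewrite /continuous_at {2}/gauss_weight normr0 powR0 ?mul0r// gt_eqF// ltr_wpDl.
    apply: cvg_trans; apply: near_eq_cvg; near=> t.
    by rewrite FE.
rewrite RintegralB// !RintegralZl//; try exact: integrable_gauss_weight.
rewrite subrr => /eqP; rewrite subr_eq0 => /eqP H.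
rewrite /half_moment mulrAC H; field.
by rewrite gt_eqF.
Unshelve. all: by end_near. Qed.

Lemma half_moment10 : half_moment 1 0 = Num.sqrt pi / 2 :> R.
Proof.
rewrite /half_moment Rintegral_itv_obnd_cbnd; last exact: integrable_gauss_weight.
rewrite /Rintegral -[RHS]/(fine (Num.sqrt pi / 2)%:E) -integral0y_gauss.
congr fine; apply: eq_integral => t _.
by rewrite /gauss_weight powRr0 !mul1r.
Qed.

(** The step from exponent [q + 2j] to [q + 2j + 2] multiplies by [((q+1)/2 + j)/c]; the numerators
    build the Pochhammer symbol. *)
Lemma half_momentD (c q : R) (k : nat) : 0 < c -> 0 <= q ->
  half_moment c (q + (2 * k)%:R) =
    c ^- k * pochhammer ((q + 1) / 2) k * half_moment c q.
Proof.
move=> c0 q0; elim: k => [|k IH].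
  by rewrite muln0 addr0 expr0 invr1 /pochhammer big_ord0 !mul1r.
rewrite (_ : q + _ = q + (2 * k)%:R + 2); last first.
  by rewrite mulnS natrD; ring.
rewrite half_momentS ?addr_ge0// IH /pochhammer big_ord_recr /= exprS natrM.
have ck : c ^+ k != 0 by rewrite expf_neq0// gt_eqF.
have c00 : c != 0 by rewrite gt_eqF.
field.
by rewrite c00 ck.
Qed.

(** For [1 <= z] the power has a nonnegative exponent, so there is no singularity at 0 and only the
    decay at infinity matters. *)
Lemma integrable_Gamma (z : R) : 1 <= z ->
  mu.-integrable `]0, +oo[ (EFin \o (fun t => t `^ (z - 1) * expR (- t))).
Proof.
move=> z1; have z10 : 0 <= z - 1 by rewrite subr_ge0.
have [K K0 HK] := powR_oneDsqr_le_expR z10.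
apply: (integrable_oneDsqr_bound (C := K)) => //.
  apply: measurable_funTS; apply: measurable_funM; first exact: measurable_powR.
  by apply: measurableT_comp => //; exact: measurable_funN.
move=> t; rewrite /= in_itv/= andbT => t0.
rewrite ger0_norm ?mulr_ge0 ?powR_ge0 ?expR_ge0//.
by rewrite mulrAC expRN ler_pdivrMr ?expR_gt0// HK// ltW.
Qed.

(** These are the images of the intervals of [exhausts_gt0] under [t -> c t^2]; a point [t] is
    caught as soon as its preimage [sqrt (t/c)] is. *)
Lemma exhausts_scaled_sqr (c : R) : 0 < c ->
  exhausts `]0, +oo[ (fun n => c * (n.+2%:R^-1) ^+ 2) (fun n => c * n.+2%:R ^+ 2).
Proof.
move=> c0; have [ab _ Dab] := exhausts_gt0 R.
split=> [n|n t|t].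
- by rewrite ltr_pM2l// ltr_pXn2r ?nnegrE ?invr_ge0//; exact: ab.
- rewrite /= !in_itv/= andbT => /andP[+ _]; apply: lt_le_trans.
  by rewrite mulr_gt0// exprn_gt0// invr_gt0.
- rewrite /= in_itv/= andbT => t0.
  have tc0 : 0 < t / c by rewrite divr_gt0.
  have /Dab : [set` `]0, +oo[] (Num.sqrt (t / c)) by rewrite /= in_itv/= andbT sqrtr_gt0.
  apply: filterS => n; rewrite !in_itv/= => /andP[an bn].
  have tE : t = c * Num.sqrt (t / c) ^+ 2.
    by rewrite sqr_sqrtr ?ltW// mulrC divfK// gt_eqF.
  apply/andP; split; [rewrite [leRHS]tE|rewrite [leLHS]tE];
  by rewrite ler_pM2l// ler_pXn2r// nnegrE ?sqrtr_ge0// invr_ge0.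
Qed.

(* The library's substitution rule on half-lines asks the derivative of the
   substitution to converge at infinity, which [2 * c * t] does not; hence the
   substitution is made on the compact intervals exhausting the half-line. *)
Lemma Gamma_half_moment (c z : R) : 0 < c -> 1 <= z ->
  Gamma z = 2 * c `^ z * half_moment c (2 * z - 1).
Proof.
move=> c0 z1.
have mD : measurable (`]0, +oo[%classic : set R) by exact: measurable_itv.
have q0 : 0 <= 2 * z - 1 by lra.
pose G (t : R) := t `^ (z - 1) * expR (- t).
pose F (t : R) := c * t ^+ 2.
have dF (t : R) : is_derive t 1 F (2 * c * t).
  apply: is_derive_eq; rewrite /GRing.scale/=; ring.
have F'E : F^`()%classic = fun t => 2 * c * t.
  by apply/funext => t; rewrite derive1E; have [_ ->] := dF t.
have cF' : continuous (fun t : R => 2 * c * t) by exact: mulrl_continuous.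
(* The substituted integrand: [(c t^2)^(z-1) exp(-c t^2)] times [2 c t]. *)
have GE : forall t : R, 0 < t ->
    ((G \o F) * F^`()%classic) t = 2 * c `^ z * gauss_weight c (2 * z - 1) t.
  move=> t t0; rewrite mulrfctE /= /G /F F'E /gauss_weight gtr0_norm//.
  rewrite powRM ?(ltW c0) ?sqr_ge0// -(powR_mulrn 2 (ltW t0)) -powRrM.
  rewrite (_ : 2 * z - 1 = 2 * (z - 1) + 1); last by ring.
  rewrite [t `^ (_ + 1)]powRD ?(gt_eqF t0) ?implybT// powRr1 ?(ltW t0)//.
  rewrite -[in RHS](subrK 1 z) [c `^ (_ + 1)]powRD ?(gt_eqF c0) ?implybT// powRr1 ?(ltW c0)//.
  by rewrite !addrK; ring.
have := cvg_Rintegral_itv mD (exhausts_scaled_sqr c0) (integrable_Gamma z1).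
move/cvg_unique; apply => //.
rewrite -RintegralZl//; last exact: integrable_gauss_weight.
have i1 : mu.-integrable `]0, +oo[
    (EFin \o (fun t => (2 * c `^ z) * gauss_weight c (2 * z - 1) t)).
  by apply: integrable_mulrl => //; exact: integrable_gauss_weight.
have := cvg_Rintegral_itv mD (exhausts_gt0 R) i1.
apply: cvg_trans; apply: near_eq_cvg; apply: nearW => n /=.
have [abn _ _] := exhausts_gt0 R.
rewrite /Rintegral (@integration_by_substitution_increasing _ F G)//.
- congr fine; apply: eq_integral => t; rewrite inE /= in_itv/= => /andP[ant _].
  by rewrite GE// (lt_le_trans _ ant)// invr_gt0.
- exact: ltW.
- move=> s t; rewrite !in_itv/= => /andP[sn _] /andP[tn _] st.
  have s0 : 0 < s by rewrite (lt_le_trans _ sn)// invr_gt0.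
  by rewrite /F ltr_pM2l// ltr_pXn2r// nnegrE ltW// (lt_trans s0).
- by move=> t _; rewrite F'E; exact: cF'.
- by rewrite F'E; apply: cvgP; apply: cvg_at_right_filter; exact: cF'.
- by rewrite F'E; apply: cvgP; apply: cvg_at_left_filter; exact: cF'.
- split.
  + by move=> t _; have [] := dF t.
  + by apply: cvg_at_right_filter; exact: is_derive_continuous (dF _).
  + by apply: cvg_at_left_filter; exact: is_derive_continuous (dF _).
- apply: continuous_in_subspaceT => t /set_mem; rewrite /= in_itv/= => /andP[Ft _].
  have t0 : 0 < t.
    by rewrite (lt_le_trans _ Ft)// mulr_gt0// exprn_gt0// invr_gt0.
  apply: cvgM.
    exact: is_derive_continuous (is_derive1_powR (z - 1) t0).
  apply: (@continuous_comp _ _ _ -%R expR); last exact: continuous_expR.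
  exact: opp_continuous.
Qed.

End gaussian_moments.

(** * Cosine and sine transforms of Gaussian weights *)

Section termwise.
Local Open Scope classical_set_scope.
Local Open Scope ring_scope.
Variable R : realType.
Local Notation mu := (@lebesgue_measure R).

Lemma Rintegral_series (f : (R -> R)^nat) (n : nat) :
  (forall k, mu.-integrable setT (EFin \o f k)) ->
  mu.-integrable setT (EFin \o (fun t => series (f ^~ t) n)) /\
  \int[mu]_t series (f ^~ t) n = series (fun k => \int[mu]_t f k t) n.
Proof.
move=> fi; elim: n => [|n [IHi IH]].
  have -> : (fun t => series (f ^~ t) 0) = cst 0.
    by apply/funext => t; rewrite /series /= big_geq.
  split; first exact: integrable0.
  by rewrite Rintegral_cst// mul0r /series /= big_geq.
have -> : (fun t => series (f ^~ t) n.+1) = (fun t => series (f ^~ t) n + f n t).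
  by apply/funext => t; rewrite seriesSr.
split; last by rewrite RintegralD// IH seriesSr.
exact: (@integrableD _ _ R mu setT measurableT _ _ IHi (fi n)).
Qed.

(** Dominated convergence for the partial sums, with [g] as a common bound; each partial sum is
    integrated by finite additivity. *)
Lemma cvg_series_Rintegral (f : (R -> R)^nat) (F g : R -> R) :
  (forall k, mu.-integrable setT (EFin \o f k)) ->
  measurable_fun setT F ->
  (forall t, series (f ^~ t) @ \oo --> F t) ->
  (forall t n, `|series (f ^~ t) n| <= g t) ->
  mu.-integrable setT (EFin \o g) ->
  mu.-integrable setT (EFin \o F) /\
  series (fun k => \int[mu]_t f k t) @ \oo --> \int[mu]_t F t.
Proof.
move=> fi mF fF fg gi.
have [||||Fi _ H] := @dominated_convergence _ _ _ mu setT measurableT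
  (fun n t => (series (f ^~ t) n)%:E) (EFin \o F) (EFin \o g) _ _ _ gi.
- by move=> n; have [/integrableP[] //] := Rintegral_series n fi.
- exact/measurable_EFinP.
- by apply/aeW => t _; apply: cvg_EFin; [exact: nearW|exact: fF].
- by apply/aeW => t n _; rewrite /= lee_fin.
split=> //.
have -> : series (fun k => \int[mu]_t f k t) =
    (fun n => \int[mu]_t series (f ^~ t) n).
  by apply/funext => n; have [_ ->] := Rintegral_series n fi.
apply: fine_cvg; rewrite fineK; last exact: integrable_fin_num.
exact: H.
Qed.

Lemma exp_coeff_ge0 (y : R) n : 0 <= y -> 0 <= exp_coeff y n.
Proof. by move=> y0; rewrite /exp_coeff /= divr_ge0// exprn_ge0. Qed.

Lemma series_exp_coeff_le_expR (y : R) n : 0 <= y -> series (exp_coeff y) n <= expR y.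
Proof.
move=> y0; rewrite /expR; apply: nondecreasing_cvgn_le.
  by apply: nondecreasing_series => k _ _; exact: exp_coeff_ge0.
exact: is_cvg_series_exp_coeff.
Qed.

(** In absolute value the cosine terms are the even-indexed terms of the series of [expR |y|], so
    [n] of them are bounded by its first [2n] terms. *)
Lemma norm_series_cos_coeff'_le (y : R) n : `|series (cos_coeff' y) n| <= expR `|y|.
Proof.
apply: le_trans (series_exp_coeff_le_expR n.*2 (normr_ge0 y)).
elim: n => [|n IH]; first by rewrite /series /= !big_geq// normr0.
rewrite doubleS !seriesSr (le_trans (ler_normD _ _))// -addrA lerD//.
rewrite -[leLHS]addr0 lerD ?exp_coeff_ge0//.
rewrite /cos_coeff' /exp_coeff /= !normrM normfV -exprnP !normrX.
by rewrite normrN1 expr1n mul1r normr_nat.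
Qed.

Lemma norm_series_sin_coeff'_le (y : R) n : `|series (sin_coeff' y) n| <= expR `|y|.
Proof.
apply: le_trans (series_exp_coeff_le_expR n.*2 (normr_ge0 y)).
elim: n => [|n IH]; first by rewrite /series /= !big_geq// normr0.
rewrite doubleS !seriesSr (le_trans (ler_normD _ _))// -addrA lerD//.
rewrite -[leLHS]add0r lerD ?exp_coeff_ge0//.
rewrite /sin_coeff' /exp_coeff /= !normrM normfV -exprnP !normrX.
by rewrite normrN1 expr1n mul1r normr_nat.
Qed.

Lemma series_mulrl (k : R) (u : R^nat) : series (fun n => k * u n) = (fun n => k * series u n).
Proof. by apply/funext => n; rewrite /series /= mulr_sumr. Qed.

Lemma gauss_weightD (c q : R) (k : nat) (t : R) : 0 <= q ->
  gauss_weight c (q + k%:R) t = gauss_weight c q t * `|t| ^+ k.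
Proof.
move=> q0; rewrite /gauss_weight.
(* At base 0 the law for sums of exponents requires [q + k] to be nonzero, hence the separate case
   [k = 0]. *)
have [->|k0] := eqVneq k 0%N; first by rewrite addr0 expr0 mulr1.
rewrite powRD ?powR_mulrn//; first by rewrite mulrAC.
by apply/implyP; rewrite paddr_eq0// pnatr_eq0 (negbTE k0) andbF.
Qed.

Lemma integrable_gauss_weight_exp_norm (c q b : R) : 0 < c -> 0 <= q ->
  mu.-integrable setT (EFin \o (fun t => gauss_weight c q t * expR (b * `|t|))).
Proof.
move=> c0 q0; apply: (@integrable_gauss_weight_expR R c q b) => //.
  apply: measurable_funM; first exact: measurable_gauss_weight.
  apply: (measurableT_comp (@measurable_expR R)); exact: measurable_funM.
by move=> t _; rewrite ger0_norm// mulr_ge0 ?gauss_weight_ge0 ?expR_ge0.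
Qed.

Lemma measurable_gauss_weightM (c q : R) (h : R -> R) : 0 <= q -> continuous h ->
  measurable_fun setT (fun t => gauss_weight c q t * h t).
Proof.
move=> q0 ch; apply: measurable_funM; first exact: measurable_gauss_weight.
exact: continuous_measurable_fun.
Qed.

Lemma continuous_cosM (x : R) : continuous (fun t => cos (x * t)).
Proof.
move=> t; apply: (@continuous_comp _ _ _ ( *%R x) cos); last exact: continuous_cos.
exact: mulrl_continuous.
Qed.

Lemma continuous_sinM (x : R) : continuous (fun t => sin (x * t)).
Proof.
move=> t; apply: (@continuous_comp _ _ _ ( *%R x) sin); last exact: continuous_sin.
exact: mulrl_continuous.
Qed.

(** As [t^(2k) = |t|^(2k)], each cosine term only raises the exponent of the weight by [2k]. The
    partial sums are dominated by the weight times [exp(|x| |t|)]. *)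
Lemma cvg_cos_moments (c q x : R) : 0 < c -> 0 <= q ->
  series (fun k => cos_coeff' x k * moment c (q + (2 * k)%:R)) @ \oo -->
  \int[mu]_t (gauss_weight c q t * cos (x * t)).
Proof.
move=> c0 q0.
pose f k t := cos_coeff' x k * gauss_weight c (q + (2 * k)%:R) t.
have fi k : mu.-integrable setT (EFin \o gauss_weight c (q + (2 * k)%:R)).
  by apply: integrable_gauss_weight => //; rewrite addr_ge0.
have fE t : f ^~ t = (fun k => gauss_weight c q t * cos_coeff' (x * t) k).
  apply/funext => k; rewrite /f gauss_weightD// /cos_coeff' exprM real_normK ?num_real//.
  by rewrite -exprM mul2n exprMn; ring.
have [] := @cvg_series_Rintegral f (fun t => gauss_weight c q t * cos (x * t))
  (fun t => gauss_weight c q t * expR (`|x| * `|t|)).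
- by move=> k; exact: integrable_mulrl.
- by apply: measurable_gauss_weightM => //; exact: continuous_cosM.
- move=> t; rewrite fE series_mulrl; apply: cvgMl_tmp.
  exact: cvg_cos_coeff'.
- move=> t n; rewrite fE series_mulrl normrM ger0_norm ?gauss_weight_ge0//.
  by rewrite ler_wpM2l ?gauss_weight_ge0// -normrM norm_series_cos_coeff'_le.
- exact: integrable_gauss_weight_exp_norm.
move=> _; under eq_fun do rewrite RintegralZl//.
exact.
Qed.

(** The extra factor [t] makes the terms even: [t * t^(2k+1) = |t|^(2k+2)], whence the moments start
    at [q + 2]. In the dominating function it raises the exponent to [q + 1]. *)
Lemma cvg_sin_moments (c q x : R) : 0 < c -> 0 <= q ->
  series (fun k => sin_coeff' x k * moment c (q + 2 + (2 * k)%:R)) @ \oo -->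
  \int[mu]_t (gauss_weight c q t * (t * sin (x * t))).
Proof.
move=> c0 q0; have q2 : 0 <= q + 2 by rewrite addr_ge0.
pose f k t := sin_coeff' x k * gauss_weight c (q + 2 + (2 * k)%:R) t.
have fi k : mu.-integrable setT (EFin \o gauss_weight c (q + 2 + (2 * k)%:R)).
  by apply: integrable_gauss_weight => //; rewrite addr_ge0.
have fE t : f ^~ t = (fun k => gauss_weight c q t * t * sin_coeff' (x * t) k).
  apply/funext => k; rewrite /f !gauss_weightD// /sin_coeff' exprM real_normK ?num_real//.
  by rewrite -exprM mul2n exprMn [t ^+ k.*2.+1]exprS; ring.
have [] := @cvg_series_Rintegral f (fun t => gauss_weight c q t * (t * sin (x * t)))
  (fun t => gauss_weight c (q + 1) t * expR (`|x| * `|t|)).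
- by move=> k; exact: integrable_mulrl.
- apply: measurable_gauss_weightM => // t; apply: cvgM; first exact: cvg_id.
  exact: continuous_sinM.
- move=> t; rewrite fE series_mulrl mulrA; apply: cvgMl_tmp.
  exact: cvg_sin_coeff'.
- move=> t n; rewrite fE series_mulrl normrM (gauss_weightD c 1)// expr1.
  rewrite [`|_ * t|]normrM ger0_norm ?gauss_weight_ge0//.
  by rewrite ler_wpM2l ?mulr_ge0 ?gauss_weight_ge0// -normrM norm_series_sin_coeff'_le.
- by apply: integrable_gauss_weight_exp_norm; rewrite ?addr_ge0.
move=> _; under eq_fun do rewrite RintegralZl//.
exact.
Qed.

(** [2^k (1/2)_k] is the product of the first [k] odd numbers and [2^k k!] that of the first [k]
    positive even ones. *)
Lemma pochhammer_half (k : nat) :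
  pochhammer (1 / 2 : R) k * (4 ^+ k * k`!%:R) = (2 * k)`!%:R.
Proof.
elim: k => [|k IH]; first by rewrite /pochhammer big_ord0 expr0 !mul1r.
rewrite /pochhammer big_ord_recr /= mulnS add2n !factS !natrM -IH exprS /pochhammer.
by rewrite -!natr1 natrM; field.
Qed.

Lemma pochhammer_3half (k : nat) :
  pochhammer (3 / 2 : R) k * (4 ^+ k * k`!%:R) = (2 * k + 1)`!%:R.
Proof.
elim: k => [|k IH]; first by rewrite /pochhammer big_ord0 expr0 !mul1r.
have -> : (2 * k.+1 + 1 = (2 * k + 1).+2)%N by rewrite mulnS -addnA.
rewrite /pochhammer big_ord_recr /= !factS !natrM -IH exprS /pochhammer.
by rewrite -!natr1 natrD natrM; field.
Qed.

(** The moment of order [2k] of [exp(-t^2)] is [sqrt pi (1/2)_k]. Against the [(2k)!] of the cosine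
    series this leaves the exponential series at [-x^2/4]. *)
Lemma cos_transform_gauss (x : R) :
  \int[mu]_t (expR (- t ^+ 2) * cos (x * t)) = Num.sqrt pi * expR (- (x ^+ 2 / 4)).
Proof.
have := @cvg_cos_moments 1 0 x ltr01 (lexx 0).
under [X in _ --> X]eq_Rintegral do rewrite /gauss_weight powRr0 !mul1r.
rewrite (_ : series _ =
  (fun n => Num.sqrt pi * series (exp_coeff (- (x ^+ 2 / 4))) n)); last first.
  rewrite -series_mulrl; congr series; apply/funext => k.
  rewrite momentE//= half_momentD// half_moment10 add0r expr1n invr1 mul1r.
  rewrite /cos_coeff' /exp_coeff /= -mul2n -pochhammer_half.
  rewrite -exprnP.
  have p0 : pochhammer (1 / 2 : R) k != 0.
    by rewrite /pochhammer; apply/prodf_neq0 => i _; rewrite gt_eqF// ltr_wpDr.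
  have k0 : k`!%:R != 0 :> R by rewrite pnatr_eq0 -lt0n fact_gt0.
  have k4 : 4 ^+ k != 0 :> R by rewrite expf_neq0.
  have -> : (- (x ^+ 2 / 4)) ^+ k = (-1) ^+ k * x ^+ (2 * k) / 4 ^+ k.
    by rewrite (exprNn (x ^+ 2 / 4)) exprMn exprVn exprM mulrA.
  field.
  by rewrite k0 k4.
move=> H; have /(cvg_unique _ H) -> // : Num.sqrt pi * series (exp_coeff (- (x ^+ 2 / 4))) n
    @[n --> \oo] --> Num.sqrt pi * expR (- (x ^+ 2 / 4)).
  by apply: cvgMl_tmp; exact: is_cvg_series_exp_coeff.

Qed.

End termwise.

(** * Fourier transform of the Hermite functions *)

Section hermite_fourier.
Local Open Scope classical_set_scope.
Local Open Scope ring_scope.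
Variable R : realType.
Local Notation mu := (@lebesgue_measure R).

Lemma hermiteSS (n : nat) :
  hermite R n.+2 = 2 *: 'X * hermite R n.+1 - (2 * n.+1)%:R *: hermite R n.
Proof. by []. Qed.

(** Strong induction, differentiating the three-term recurrence. *)
Lemma deriv_hermite (n : nat) :
  (hermite R n.+1)^`() = (2 * n.+1)%:R *: hermite R n.
Proof.
elim/ltn_ind: n => -[_|[_|n IH]].
- by rewrite /= derivZ derivX muln1.
- rewrite /= derivB derivM !derivZ derivX derivC scaler0 subr0.
  by rewrite -!scalerAl -!scalerAr mulr1 mul1r !scalerA -scalerDl; congr (_ *: _); ring.
rewrite hermiteSS derivB derivM !derivZ derivX !IH//.
rewrite -!scalerAl -!scalerAr mul1r hermiteSS.
rewrite -!mul_polyC !rmorph_nat !natrM -!natr1.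
by ring.
Qed.

(** With the derivative in place of the lower polynomial, the recurrence says that differentiating
    [exp(-t^2) H_n] gives [-exp(-t^2) H_(n+1)]. *)
Lemma hermiteS (n : nat) :
  hermite R n.+1 = 2 *: 'X * hermite R n - (hermite R n)^`().
Proof.
case: n => [|n]; first by rewrite /= derivC subr0 mulr1.
by rewrite deriv_hermite.
Qed.
(** The over-scaled Hermite function without its normalising constant. *)
Definition hermite_gauss (n : nat) (t : R) := expR (- t ^+ 2) * (hermite R n).[t].

(** Induction on [p] in the form [p * 'X + c]. The exponent [m] is kept general so that the weight
    can absorb the factor [|t|] coming from ['X]. *)
Lemma poly_gauss_weight_bound (p : {poly R}) (m : nat) :
  exists K, forall t, `|p.[t]| * gauss_weight 1 m%:R t * oneDsqr t <= K.
Proof.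
elim/poly_ind: p m => [|p c IH] m.
  by exists 0 => t; rewrite horner0 normr0 !mul0r.
have [K HK] := IH m.+1.
have [L HL] := @gauss_weight_bound R 1 m%:R 0 ltr01 (ler0n _ m).
exists (K + `|c| * L) => t.
have D0 : 0 <= gauss_weight 1 m%:R t * oneDsqr t.
  by rewrite mulr_ge0 ?gauss_weight_ge0// addr_ge0// sqr_ge0.
rewrite -mulrA hornerMXaddC (le_trans (ler_wpM2r D0 (ler_normD _ _)))//.
rewrite mulrDl lerD//.
  apply: le_trans (HK t).
  by rewrite -natr1 (@gauss_weightD _ _ _ 1)// expr1 normrM; lra.
rewrite ler_wpM2l//.
by have := HL t; rewrite mul0r expR0 mulr1.
Qed.

Lemma hermite_gauss_bound (n : nat) :
  exists K, forall t, `|hermite_gauss n t| * oneDsqr t <= K.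
Proof.
have [K HK] := poly_gauss_weight_bound (hermite R n) 0.
exists K => t; apply: le_trans (HK t).
rewrite /hermite_gauss /gauss_weight powRr0 !mul1r normrM.
by rewrite [`|expR _|]ger0_norm ?expR_ge0// [expR _ * _]mulrC.
Qed.

Lemma is_derive_hermite_gauss (n : nat) (t : R) :
  is_derive t 1 (hermite_gauss n) (- hermite_gauss n.+1 t).
Proof.
apply: is_derive_eq.
rewrite /hermite_gauss hermiteS !hornerE /GRing.scale/=; ring.
Qed.

Lemma continuous_hermite_gauss (n : nat) : continuous (hermite_gauss n).
Proof. by move=> t; exact: is_derive_continuous (is_derive_hermite_gauss n t). Qed.

Lemma integrable_hermite_gaussM (n : nat) (h : R -> R) :
  continuous h -> (forall t, `|h t| <= 1) ->
  mu.-integrable setT (EFin \o (fun t => hermite_gauss n t * h t)).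
Proof.
move=> ch h1; have [K HK] := hermite_gauss_bound n.
apply: (integrable_oneDsqr_bound (C := K)) => //.
  apply: continuous_measurable_fun => t.
  by apply: cvgM; [exact: continuous_hermite_gauss|exact: ch].
move=> t _; apply: le_trans (HK t); rewrite ler_wpM2r//.
by rewrite normrM ler_piMr// h1.
Qed.

Lemma hermite_gaussM_cvg0 (n : nat) (h : R -> R) : (forall t, `|h t| <= 1) ->
  hermite_gauss n t * h t @[t --> +oo] --> 0 /\
  hermite_gauss n t * h t @[t --> -oo] --> 0.
Proof.
move=> h1; have [K HK] := hermite_gauss_bound n.
have fK t : `|hermite_gauss n t * h t| * oneDsqr t <= K.
  apply: le_trans (HK t); rewrite ler_wpM2r//.
  by rewrite normrM ler_piMr// h1.
split; [exact: oneDsqr_bound_cvgy fK|exact: oneDsqr_bound_cvgNy fK].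
Qed.

Definition cos_hermite n (xi : R) := \int[mu]_t (hermite_gauss n t * cos (xi * t)).
Definition sin_hermite n (xi : R) := \int[mu]_t (hermite_gauss n t * sin (xi * t)).

Lemma integrable_cos_hermite n xi :
  mu.-integrable setT (EFin \o (fun t => hermite_gauss n t * cos (xi * t))).
Proof.
apply: integrable_hermite_gaussM; first exact: continuous_cosM.
by move=> t; exact: cos_max.
Qed.

Lemma integrable_sin_hermite n xi :
  mu.-integrable setT (EFin \o (fun t => hermite_gauss n t * sin (xi * t))).
Proof.
apply: integrable_hermite_gaussM; first exact: continuous_sinM.
by move=> t; exact: sin_max.
Qed.

(** Integration by parts: [f] is the derivative of [hermite_gauss n t * cos (xi * t)], which
    vanishes at both infinities. *)
Lemma cos_hermiteS n xi : cos_hermite n.+1 xi = - xi * sin_hermite n xi.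
Proof.
have [Fy FNy] := @hermite_gaussM_cvg0 n (fun t => cos (xi * t)) (fun t => cos_max _).
pose f t := - xi * (hermite_gauss n t * sin (xi * t)) - hermite_gauss n.+1 t * cos (xi * t).
have i1 := integrable_mulrl (- xi) measurableT (integrable_sin_hermite n xi).
have i2 := integrable_cos_hermite n.+1 xi.
have : \int[mu]_t f t = 0 - 0.
  apply: Rintegral_FTC2T Fy FNy.
  - exact: integrable_sub.
  - move=> t; apply: cvgB; first apply: cvgM; first exact: cvg_cst.
      by apply: cvgM; [exact: continuous_hermite_gauss|exact: continuous_sinM].
    by apply: cvgM; [exact: continuous_hermite_gauss|exact: continuous_cosM].
  - move=> t; have d := is_derive_hermite_gauss n t.
    apply: is_derive_eq.
    rewrite /f /GRing.scale/=; ring.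
rewrite subrr RintegralB// RintegralZl//; last exact: integrable_sin_hermite.
by move=> /eqP; rewrite subr_eq0 => /eqP ->.
Qed.

Lemma sin_hermiteS n xi : sin_hermite n.+1 xi = xi * cos_hermite n xi.
Proof.
have [Fy FNy] := @hermite_gaussM_cvg0 n (fun t => sin (xi * t)) (fun t => sin_max _).
pose f t := xi * (hermite_gauss n t * cos (xi * t)) - hermite_gauss n.+1 t * sin (xi * t).
have i1 := integrable_mulrl xi measurableT (integrable_cos_hermite n xi).
have i2 := integrable_sin_hermite n.+1 xi.
have : \int[mu]_t f t = 0 - 0.
  apply: Rintegral_FTC2T Fy FNy.
  - exact: integrable_sub.
  - move=> t; apply: cvgB; first apply: cvgM; first exact: cvg_cst.
      by apply: cvgM; [exact: continuous_hermite_gauss|exact: continuous_cosM].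
    by apply: cvgM; [exact: continuous_hermite_gauss|exact: continuous_sinM].
  - move=> t; have d := is_derive_hermite_gauss n t.
    apply: is_derive_eq.
    rewrite /f /GRing.scale/=; ring.
rewrite subrr RintegralB// RintegralZl//; last exact: integrable_cos_hermite.
by move=> /eqP; rewrite subr_eq0 => /eqP ->.
Qed.

Lemma cos_hermite0 xi : cos_hermite 0 xi = Num.sqrt pi * expR (- (xi ^+ 2 / 4)).
Proof.
rewrite -cos_transform_gauss; apply: eq_Rintegral => t _.
by rewrite /hermite_gauss /= hornerC mulr1.
Qed.

Lemma sin_hermite0 xi : sin_hermite 0 xi = 0.
Proof.
apply: Rintegral_odd; first exact: integrable_sin_hermite.
  by move=> t; apply: cvgM; [exact: continuous_hermite_gauss|exact: continuous_sinM].
by move=> t; rewrite /hermite_gauss /= !hornerC sqrrN mulrN sinN mulrN.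
Qed.

(** Two steps of the recurrences multiply each transform by [-xi^2], and the sine transform starts
    at 0. *)
Lemma cos_sin_hermite_even n xi :
  cos_hermite (2 * n) xi = (-1) ^+ n * xi ^+ (2 * n) * cos_hermite 0 xi /\
  sin_hermite (2 * n) xi = 0.
Proof.
elim: n => [|n [IHc IHs]]; first by rewrite muln0 !expr0 !mul1r sin_hermite0.
rewrite mulnS add2n cos_hermiteS !sin_hermiteS cos_hermiteS IHc IHs.
by rewrite !mulr0 !exprS; split => //; ring.
Qed.

Lemma cos_hermite_odd n xi : cos_hermite (2 * n + 1) xi = 0.
Proof.
by rewrite addn1 cos_hermiteS; have [_ ->] := cos_sin_hermite_even n xi; rewrite mulr0.
Qed.

Lemma sin_hermite_odd n xi : sin_hermite (2 * n + 1) xi =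
  (-1) ^+ n * xi ^+ (2 * n + 1) * (Num.sqrt pi * expR (- (xi ^+ 2 / 4))).
Proof.
rewrite addn1 sin_hermiteS; have [-> _] := cos_sin_hermite_even n xi.
by rewrite cos_hermite0 [xi ^+ (2 * n).+1]exprS; ring.
Qed.

End hermite_fourier.

(** * The fractional Laplacian *)

Section fractional_laplacian_hermite.
Local Open Scope classical_set_scope.
Local Open Scope ring_scope.
Variable R : realType.
Local Notation mu := (@lebesgue_measure R).

(** [4^-1] is the rate of the Gaussian on the Fourier side. There [c^z = 2^(-2z)], so the factor
    [2 c^z] relating the half moment to [Gamma z] is the inverse of [2^(2z-1)]. *)
Lemma half_moment_Gamma (z : R) : 1 <= z ->
  half_moment 4^-1 (2 * z - 1) = 2 `^ (2 * z - 1) * Gamma z.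
Proof.
move=> z1; rewrite (@Gamma_half_moment R 4^-1)// ?invr_gt0//.
have -> : 4^-1 `^ z = 2 `^ (- (2 * z)) :> R.
  have -> : 4^-1 = 2 `^ (- 2) :> R by rewrite powRN (powR_mulrn 2)// -natrX.
  by rewrite -powRrM mulNr.
have e : 2 `^ (2 * z - 1) * (2 * 2 `^ (- (2 * z))) = 1 :> R.
  rewrite mulrCA -powRD ?pnatr_eq0 ?implybT//.
  rewrite (_ : 2 * z - 1 - 2 * z = -1); last by ring.
  by rewrite powR_inv1// divff// pnatr_eq0.
by rewrite mulrA e mul1r.
Qed.

Lemma Gamma_half_integer (n : nat) :
  Gamma (n%:R + 3 / 2 : R) =
    Num.sqrt pi * (2 * n + 1)`!%:R / (2 ^+ (2 * n + 1) * n`!%:R).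
Proof.
(* At [c = 1] this is twice the half moment of order [2z - 1 = 2(n+1)], an even moment of the
   standard Gaussian weight. *)
rewrite (@Gamma_half_moment R 1)//; last by rewrite ler_wpDl//; lra.
rewrite powR1 mulr1 (_ : 2 * _ - 1 = 0 + (2 * n.+1)%:R); last first.
  by rewrite natrM -natr1; field.
rewrite half_momentD// half_moment10 expr1n invr1 mul1r add0r.
have n0 : n`!%:R != 0 :> R by rewrite pnatr_eq0 -lt0n fact_gt0.
have := pochhammer_half R n.+1.
rewrite mulnS add2n !factS !natrM addn1 factS natrM => H.
have n10 : n.+1%:R != 0 :> R by [].
have n40 : 4 ^+ n.+1 != 0 :> R by rewrite expf_neq0.
have -> : pochhammer (1 / 2 : R) n.+1 =
    (2 * n).+2%:R * ((2 * n).+1%:R * (2 * n)`!%:R) / (4 ^+ n.+1 * (n.+1%:R * n`!%:R)).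
  by rewrite -H mulfK// !mulf_neq0.
have -> : (2 * n).+2%:R = 2 * n.+1%:R :> R by rewrite -natrM mulnS.
have -> : 4 ^+ n.+1 = 2 * 2 ^+ (2 * n).+1 :> R.
  have e : ((2 * n).+2 = 2 * n.+1)%N by rewrite mulnS.
  by rewrite -exprS e exprM; congr (_ ^+ _); rewrite -natrX.
field.
by rewrite n0 nat1r n10 expf_neq0.
Qed.

(* When [A = 0] both sides vanish, whatever the junk value of [limn u]. *)
Lemma scaled_cvg_lim (A l : R) (u : R^nat) :
  A * u n @[n --> \oo] --> l -> l = A * limn u.
Proof.
have [->|A0] := eqVneq A 0.
  under eq_fun do rewrite mul0r.
  by move=> H; rewrite mul0r; apply: (cvg_unique _ H) => //; exact: cvg_cst.
move=> H; have : u n @[n --> \oo] --> A^-1 * l.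
  have -> : u = (fun n => A^-1 * (A * u n)) by apply/funext => n; rewrite mulKf.
  exact: cvgMl_tmp.
by move=> /(cvg_lim (@Rhausdorff R)) ->; rewrite mulVKf.
Qed.

(** The moments contribute [c^(-k) ((q+3)/2)_k], and [(2k+1)! = (3/2)_k 4^k k!] turns the sine
    coefficients into the rest of the general term of 1F1. *)
Lemma sin_transform_gauss_weight (c q x : R) : 0 < c -> 0 <= q ->
  \int[mu]_t (gauss_weight c q t * (t * sin (x * t))) =
  2 * half_moment c (q + 2) * x * hyp1F1 ((q + 3) / 2) (3 / 2) (- (x ^+ 2 / (4 * c))).
Proof.
move=> c0 q0; have q2 : 0 <= q + 2 by rewrite addr_ge0.
(* Convergence of the moment series gives the value of the limit in [hyp1F1]; the prefactor can be
   0, namely at [x = 0]. *)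
apply: scaled_cvg_lim; have := @cvg_sin_moments R c q x c0 q0.
rewrite -(series_mulrl (2 * half_moment c (q + 2) * x)).
rewrite [X in series X @ _ --> _ -> _](_ : _ = (fun k => 2 * half_moment c (q + 2) * x *
  (pochhammer ((q + 3) / 2) k / pochhammer (3 / 2) k *
   ((- (x ^+ 2 / (4 * c))) ^+ k / k`!%:R)))) //; apply/funext => k.
rewrite momentE ?addr_ge0// half_momentD// /sin_coeff' -exprnP -mul2n -addn1 -pochhammer_3half.
rewrite (_ : (q + 2 + 1) = q + 3); last by ring.
have -> : (- (x ^+ 2 / (4 * c))) ^+ k = (-1) ^+ k * x ^+ (2 * k) / (4 ^+ k * c ^+ k).
  by rewrite (exprNn (x ^+ 2 / _)) exprMn exprVn [(4 * c) ^+ k]exprMn exprM [LHS]mulrA.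
have p0 : pochhammer (3 / 2 : R) k != 0.
  by rewrite /pochhammer; apply/prodf_neq0 => i _; rewrite gt_eqF// ltr_pwDl.
have k0 : k`!%:R != 0 :> R by rewrite pnatr_eq0 -lt0n fact_gt0.
have k4 : 4 ^+ k != 0 :> R by rewrite expf_neq0.
have ck : c ^+ k != 0 by rewrite expf_neq0// gt_eqF.
rewrite addn1 exprS; field.
by rewrite p0 k0 k4 ck.
Qed.

Lemma integrable_gauss_weight_oddM (c q : R) (h : R -> R) : 0 < c -> 0 <= q ->
  continuous h -> (forall t, `|h t| <= 1) ->
  mu.-integrable setT (EFin \o (fun t => gauss_weight c q t * (t * h t))).
Proof.
move=> c0 q0 ch h1; apply: (@integrable_gauss_weight_expR R c (q + 1) 0) => //.
- by rewrite addr_ge0.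
- by apply: measurable_gauss_weightM => // t; apply: cvgM; [exact: cvg_id|exact: ch].
move=> t _; rewrite mul0r expR0 mulr1 (@gauss_weightD _ _ _ 1)// expr1.
rewrite normrM ger0_norm ?gauss_weight_ge0// ler_wpM2l ?gauss_weight_ge0//.
by rewrite normrM ler_piMr// h1.
Qed.

Lemma fourier_integrand_hermiteE (N : nat) (xi y : R) :
  fourier_integrand (fun y => (over_scaled_hermite N y)%:C) xi y =
  ((Num.sqrt (2 ^+ N * N`!%:R))^-1 * (hermite_gauss N y * cos (xi * y))) +i*
  (- (Num.sqrt (2 ^+ N * N`!%:R))^-1 * (hermite_gauss N y * sin (xi * y))).
Proof.
rewrite /fourier_integrand /expi cosN sinN [y * xi]mulrC /over_scaled_hermite /hermite_gauss.
by apply/eqP; rewrite eq_complex /=; apply/andP; split; apply/eqP; ring.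
Qed.

Lemma cintegrable_fourier_integrand_hermite (N : nat) (xi : R) :
  cintegrable (fourier_integrand (fun y => (over_scaled_hermite N y)%:C) xi).
Proof.
split.
  under eq_fun do rewrite fourier_integrand_hermiteE/=.
  by apply: integrable_mulrl => //; exact: integrable_cos_hermite.
under eq_fun do rewrite fourier_integrand_hermiteE/=.
by apply: integrable_mulrl => //; exact: integrable_sin_hermite.
Qed.

Lemma fourier_hermite (N : nat) (xi : R) :
  fourier (fun y => (over_scaled_hermite N y)%:C) xi =
  ((Num.sqrt (2 * pi))^-1 * (Num.sqrt (2 ^+ N * N`!%:R))^-1)%:C *
  (cos_hermite N xi -i* sin_hermite N xi).
Proof.
rewrite /fourier /cintegral.
under eq_Rintegral do rewrite fourier_integrand_hermiteE/=.
rewrite RintegralZl//; last exact: integrable_cos_hermite.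
under [X in _ +i* X]eq_Rintegral do rewrite fourier_integrand_hermiteE/=.
rewrite RintegralZl//; last exact: integrable_sin_hermite.
apply/eqP; rewrite eq_complex /= /cos_hermite /sin_hermite.
by apply/andP; split; apply/eqP; ring.
Qed.

(** The constants of the forward transform: its [1/sqrt(2 pi)], the normalisation, the sign left
    from [(-i)^(2n+1)] after taking out [-i], and the [sqrt pi] of the Gaussian. *)
Definition hermite_scale (n : nat) : R := (Num.sqrt (2 * pi))^-1 *
  (Num.sqrt (2 ^+ (2 * n + 1) * (2 * n + 1)`!%:R))^-1 * (-1) ^+ n * Num.sqrt pi.

(** The Fourier transform is [-i] times a real odd function, and [-i (cos + i sin) = sin - i cos].
    Writing [xi^(2n+1) = |xi|^(2n) xi] merges the even power with [|xi|^alpha] in the weight. *)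
Lemma frac_laplacian_integrand_hermiteE (alpha x : R) (n : nat) (xi : R) : 0 < alpha ->
  frac_laplacian_integrand alpha
    (fun y => (over_scaled_hermite (2 * n + 1) y)%:C) x xi =
  (hermite_scale n * (gauss_weight 4^-1 (alpha + (2 * n)%:R) xi * (xi * sin (x * xi)))) +i*
  (- hermite_scale n * (gauss_weight 4^-1 (alpha + (2 * n)%:R) xi * (xi * cos (x * xi)))).
Proof.
move=> a0; rewrite /frac_laplacian_integrand fourier_hermite.
rewrite cos_hermite_odd sin_hermite_odd gauss_weightD ?(ltW a0)// /gauss_weight.
rewrite exprM real_normK ?num_real// -exprM /expi /hermite_scale addn1 [xi ^+ _.+1]exprS.
rewrite [xi ^+ 2 / 4]mulrC.
by apply/eqP; rewrite eq_complex /=; apply/andP; split; apply/eqP; ring.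
Qed.

End fractional_laplacian_hermite.

Unset Implicit Arguments.

Theorem theorem3p2 (R : realType) (alpha : R) (halpha : 0 < alpha < 2)
    (n : nat) (x : R) :
  let u := fun y : R => (over_scaled_hermite (2 * n + 1) y)%:C in
  frac_laplacian_defined alpha u x /\
  frac_laplacian alpha u x =
    (2 `^ (alpha + 1)
     * ((-1) ^+ n * Num.sqrt ((2 * n + 1)`!%:R)
        / (2 `^ (n%:R + 1 / 2) * n`!%:R))
     * (Gamma (n%:R + alpha / 2 + 3 / 2) / Gamma (n%:R + 3 / 2))
     * x * hyp1F1 (n%:R + alpha / 2 + 3 / 2) (3 / 2) (- x ^+ 2))%:C.
Proof.
have /andP[a0 _] := halpha => u.
set q := alpha + (2 * n)%:R.
have q0 : 0 <= q by rewrite addr_ge0// ltW.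
have c0 : 0 < 4^-1 :> R by rewrite invr_gt0.
have isin := integrable_gauss_weight_oddM c0 q0 (@continuous_sinM R x) (fun t => sin_max _).
have icos := integrable_gauss_weight_oddM c0 q0 (@continuous_cosM R x) (fun t => cos_max _).
split.
  split; first by move=> xi; exact: cintegrable_fourier_integrand_hermite.
  split; under eq_fun do rewrite frac_laplacian_integrand_hermiteE//=.
    exact: integrable_mulrl isin.
  exact: integrable_mulrl icos.
rewrite /frac_laplacian /cintegral.
under eq_Rintegral do rewrite frac_laplacian_integrand_hermiteE//=.
under [X in _ +i* X]eq_Rintegral do rewrite frac_laplacian_integrand_hermiteE//=.
rewrite !RintegralZl// -/q.
(* The imaginary part has an odd integrand. *)
have -> : \int[@lebesgue_measure R]_t (gauss_weight 4^-1 q t * (t * cos (x * t))) = 0.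
  apply: Rintegral_odd => // [t|t].
    apply: cvgM; first exact: continuous_gauss_weight.
    by apply: cvgM; [exact: cvg_id|exact: continuous_cosM].
  by rewrite gauss_weightN mulrN cosN mulNr mulrN.
(* With [c = 4^-1], [4 c = 1] and the argument of 1F1 becomes [-x^2]. *)
rewrite sin_transform_gauss_weight// mulfV// mulr0 divr1.
set a := n%:R + alpha / 2 + 3 / 2.
have -> : (q + 3) / 2 = a by rewrite /q /a natrM; field.
have -> : q + 2 = 2 * a - 1 by rewrite /q /a natrM; field.
have n0 : 0 <= n%:R :> R by [].
rewrite half_moment_Gamma; last by rewrite /a; lra.
rewrite Gamma_half_integer /hermite_scale.
set F := hyp1F1 _ _ _.
rewrite -[_ +i* 0]/(_%:C) -rmorphM; congr (_%:C).
(* This splits off the factor [2^(alpha+1)] of the claim. *)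
have -> : 2 * a - 1 = (alpha + 1) + (2 * n + 1)%:R by rewrite /a natrD natrM; field.
rewrite [2 `^ (_ + _%:R)]powRD ?pnatr_eq0 ?implybT// powR_mulrn//.
rewrite [2 `^ (_ + 1 / 2)]powRD ?pnatr_eq0 ?implybT// powR_mulrn// div1r powR12_sqrt//.
rewrite !sqrtrM ?exprn_ge0// exprD mulnC exprM sqrtrM ?sqr_ge0// sqrtr_sqr expr1.
rewrite ger0_norm ?exprn_ge0//.
set s := Num.sqrt 2; set p := Num.sqrt pi; set f := Num.sqrt (n * 2 + 1)`!%:R.
(* The factorial, and next the leading 2, become squares of the roots [f] and [s]: [field] treats
   these as indeterminates and does not know their squares. *)
have -> : (n * 2 + 1)`!%:R = f ^+ 2 by rewrite sqr_sqrtr.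
have -> : 2 * (2 `^ (alpha + 1) * (2 ^+ n ^+ 2 * 2) * Gamma a) =
    s ^+ 2 * (2 `^ (alpha + 1) * (2 ^+ n ^+ 2 * 2) * Gamma a).
  by rewrite /s sqr_sqrtr.
have s0 : s != 0 by rewrite gt_eqF// sqrtr_gt0.
have p0 : p != 0 by rewrite gt_eqF// sqrtr_gt0 pi_gt0.
have f0 : f != 0 by rewrite gt_eqF// sqrtr_gt0 ltr0n fact_gt0.
have nf0 : n`!%:R != 0 :> R by rewrite pnatr_eq0 -lt0n fact_gt0.
field.
by rewrite s0 p0 f0 nf0 expf_neq0.
Qed.
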